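(* Let $S$ be a finite set of alternatives, $V=\{1,\dots,N\}$ a finite set of voters, and $f:\Pi_S^V\to\Pi_S$ a social welfare function. Then $f$ satisfies Independence of Irrelevant Alternatives if and only if $f$ is clerical-dictatorial.
   Context: $\Pi_S$ denotes the set of complete transitive binary relations (weak preferences) on $S$; for $R\in\Pi_S$ we write $x\le_R y$ for $(x,y)\in R$, and $x<_R y$, $x=_R y$ have the obvious meanings. A configuration is ${\bf R}=(R_1,\dots,R_N)\in\Pi_S^V$. A social welfare function (SWF) is any map $f:\Pi_S^V\to\Pi_S$ (for any finite voter set $V$, possibly empty). Independence of Irrelevant Alternatives (IIA): whenever ${\bf P},{\bf Q}\in\Pi_S^V$ agree (for every voter) on the pair $\{x,y\}$, $f({\bf P})$ and $f({\bf Q})$ agree on $\{x,y\}$. $f$ is null if $x=_{f({\bf R})}y$ for all ${\bf R}$ and all $x,y$. $f$ is dictatorial with dictator $i$ if either for all $x,y,{\bf R}$: $x\le_{f({\bf R})}y\Rightarrow x\le_{R_i}y$, or for all $x,y,{\bf R}$: $x\le_{f({\bf R})}y\Rightarrow y\le_{R_i}x$. For ${\bf R}\in\Pi_S^V$, ${\bf R}_{-i}\in\Pi_S^{V\setminus\{i\}}$ is its restriction to voters other than $i$. A dictatorial $f$ with dictator $i$ defers to $g:\Pi_S^{V\setminus\{i\}}\to\Pi_S$ over $i$ if for all $x,y\in S$ and ${\bf R}$ with $x=_{R_i}y$: $x\le_{f({\bf R})}y\iff x\le_{g({\bf R}_{-i})}y$. $f$ is clerical with cleric $C\in\Pi_S$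 if for all $x,y,{\bf R}$: $x\le_{f({\bf R})}y\Rightarrow x\le_C y$. For $A\subseteq S$, the restriction $f|_A:\Pi_A^V\to\Pi_A$ is defined by: given ${\bf R}\in\Pi_A^V$ pick any ${\bf R}'\in\Pi_S^V$ agreeing with ${\bf R}$ on all pairs in $A$, and set $x\le_{f|_A({\bf R})}y$ iff $x\le_{f({\bf R}')}y$ for $x,y\in A$; $f|_A$ is well defined if this does not depend on the choice of ${\bf R}'$. Clerical-dictatorial (recursive definition): $f:\Pi_S^V\to\Pi_S$ is clerical-dictatorial if it is null, or $|S|\le 2$, or there is a cleric $C\in\Pi_S$ such that (1) $f$ is clerical with cleric $C$, and (2) for every equivalence class $A$ of $C$: (a) $f|_A$ is well defined and is null, dictatorial, or $|A|=2$; (b) if $f|_A$ is dictatorial (with dictator $j$) then it defers over $j$ to a clerical-dictatorial function $\Pi_A^{V\setminus\{j\}}\to\Pi_A$. *)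

(* Defs.v *)
From HB Require Import structures.
From mathcomp Require Import all_boot.

Set Implicit Arguments.
Unset Strict Implicit.
Unset Printing Implicit Defensive.

(* Completeness is required at x = y too, so it includes reflexivity. *)
Definition weak_order (S : finType) (r : {set S * S}) : bool :=
  [forall x, forall y, ((x, y) \in r) || ((y, x) \in r)] &&
  [forall x, forall y, forall z,
     ((x, y) \in r) && ((y, z) \in r) ==> ((x, z) \in r)].

Record pref (S : finType) : Type :=
  Pref { pref_graph :> {set S * S}; _ : weak_order pref_graph }.

#[local] Set Warnings "-redundant-canonical-projection,-projection-no-head-constant".
HB.instance Definition _ (S : finType) := [isSub for @pref_graph S].
HB.instance Definition _ (S : finType) := [Finite of pref S by <:].

Section Preferences.
Variable S : finType.
Implicit Types (P Q : pref S) (x y : S).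

Definition pref_le P x y : bool := (x, y) \in pref_graph P.
Definition pref_eq P x y : bool := pref_le P x y && pref_le P y x.

Definition agree P Q x y : Prop :=
  pref_le P x y = pref_le Q x y /\ pref_le P y x = pref_le Q y x.

Definition pref_classes P : {set {set S}} :=
  equivalence_partition (pref_eq P) [set: S].

Lemma pref_le_total P x y : pref_le P x y || pref_le P y x.
Proof.
by rewrite /pref_le; case: P => r /= /andP[/forallP/(_ x)/forallP/(_ y)].
Qed.

Lemma pref_le_trans P : transitive (pref_le P).
Proof.
move=> y x z; rewrite /pref_le; case: P => r /= /andP[_].
move=> /forallP/(_ x)/forallP/(_ y)/forallP/(_ z)/implyP tr xy yz.
by apply: tr; rewrite xy.
Qed.

Lemma weak_order_of (r : rel S) :
  total r -> transitive r -> weak_order [set p | r p.1 p.2].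
Proof.
move=> tot tr; apply/andP; split.
  by apply/forallP=> x; apply/forallP=> y; rewrite !inE /= tot.
apply/forallP=> x; apply/forallP=> y; apply/forallP=> z; rewrite !inE /=.
by apply/implyP=> /andP[]; apply: tr.
Qed.

Definition pref_of (r : rel S) (tot : total r) (tr : transitive r) : pref S :=
  Pref (weak_order_of tot tr).

Lemma pref_ofE (r : rel S) (tot : total r) (tr : transitive r) x y :
  pref_le (pref_of tot tr) x y = r x y.
Proof. by rewrite /pref_le inE. Qed.

End Preferences.

Definition subset_type (S : finType) (A : {set S}) : finType := {x : S | x \in A}.
Definition other_voters (V : finType) (i : V) : finType := {j : V | j != i}.

Definition config (V S : finType) : Type := {ffun V -> pref S}.
Definition swf (V S : finType) : Type := config V S -> pref S.

Section Restriction.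
Variables (S : finType) (A : {set S}).

Definition res_rel (P : pref S) : rel (subset_type A) :=
  fun x y => pref_le P (val x) (val y).

Lemma res_rel_total P : total (res_rel P).
Proof. by move=> x y; apply: pref_le_total. Qed.

Lemma res_rel_trans P : transitive (res_rel P).
Proof. by move=> y x z; apply: pref_le_trans. Qed.

Definition pref_res (P : pref S) : pref (subset_type A) :=
  pref_of (@res_rel_total P) (@res_rel_trans P).

(* One particular extension of a preference on A to S: the alternatives
   outside A are all indifferent and lie strictly above those of A. *)
Definition ext_rel (P : pref (subset_type A)) : rel S := fun x y =>
  match insub x, insub y with
  | Some a, Some b => pref_le P a b
  | None, Some _ => false
  | _, None => true
  end.

Lemma ext_rel_total P : total (ext_rel P).
Proof.
move=> x y; rewrite /ext_rel.
by case: (insub x) => [a|]; case: (insub y) => [b|] //; apply: pref_le_total.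
Qed.

Lemma ext_rel_trans P : transitive (ext_rel P).
Proof.
move=> y x z; rewrite /ext_rel.
by case: (insub x) => [a|]; case: (insub y) => [b|]; case: (insub z) => [c|] //;
  apply: pref_le_trans.
Qed.

Definition pref_ext (P : pref (subset_type A)) : pref S :=
  pref_of (@ext_rel_total P) (@ext_rel_trans P).

Lemma pref_extK : cancel pref_ext pref_res.
Proof.
move=> P; apply/val_inj/setP=> -[x y].
rewrite -[LHS]/(pref_le _ x y) pref_ofE /res_rel pref_ofE /ext_rel.
by rewrite !valK.
Qed.

End Restriction.

Section Voters.
Variables V S : finType.
Implicit Types (f : swf V S) (R : config V S).

Definition IIA f : Prop := forall (x y : S) (P Q : config V S),
  (forall i, agree (P i) (Q i) x y) -> agree (f P) (f Q) x y.

Definition null f : Prop := forall R x y, pref_eq (f R) x y.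

Definition dictator f (i : V) : Prop :=
  (forall x y R, pref_le (f R) x y -> pref_le (R i) x y) \/
  (forall x y R, pref_le (f R) x y -> pref_le (R i) y x).

Definition dictatorial f : Prop := exists i, dictator f i.

Definition clerical f (C : pref S) : Prop :=
  forall x y R, pref_le (f R) x y -> pref_le C x y.

Definition drop_voter (i : V) R : config (other_voters i) S :=
  [ffun j => R (val j)].

Definition defers f (i : V) (g : swf (other_voters i) S) : Prop :=
  dictator f i /\
  forall x y R, pref_eq (R i) x y ->
    (pref_le (f R) x y <-> pref_le (g (drop_voter i R)) x y).

Definition extends (A : {set S}) (R : config V (subset_type A)) R' : Prop :=
  forall i, pref_res A (R' i) = R i.

Definition res_well_defined f (A : {set S}) : Prop :=
  forall (R : config V (subset_type A)) (R' R'' : config V S),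
    extends R R' -> extends R R'' -> pref_res A (f R') = pref_res A (f R'').

(* f|_A computed with the extension pref_ext; when res_well_defined f A holds
   every other extension gives the same value. *)
Definition swf_res f (A : {set S}) : swf V (subset_type A) :=
  fun R : config V (subset_type A) => pref_res A (f [ffun i => pref_ext (R i)]).

End Voters.

Arguments swf_res {V S} f A _.
Arguments defers {V S} f i g.

Inductive clerical_dictatorial (V S : finType) (f : swf V S) : Prop :=
| CD_null of null f
| CD_small of #|S| <= 2
| CD_cleric (C : pref S) of
    clerical f C &
    (forall A : {set S}, A \in pref_classes C ->
       [/\ res_well_defined f A,
           [\/ null (swf_res f A), dictatorial (swf_res f A) | #|A| = 2] &
           forall j : V, dictator (swf_res f A) j ->
             exists2 g : swf (other_voters j) (subset_type A),
               defers (swf_res f A) j g & clerical_dictatorial g]).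

(* Main.v *)
Require Import Defs.
From mathcomp Require Import all_boot zify.

Set Implicit Arguments.
Unset Strict Implicit.
Unset Printing Implicit Defensive.

(** Given an IIA function [f], the cleric [C] orders [x] below [y] when some
    profile makes [f] rank [x] weakly below [y]; it is transitive because a
    profile on [{x, y}] and a profile on [{y, z}] can always be glued.  Inside a
    class of [C] no pair has an imposed strict ranking, so if the class has at
    least three elements Wilson's theorem makes [f] null or dictatorial there:
    unanimous strict preference is either always respected, always reversed, or
    always ignored; the last case forces [f] to be null, and Arrow's decisive
    set argument applies to [f] or to its reversal in the other two.  Freezing
    the dictator at total indifference yields an IIA function of the remaining
    voters, and one concludes by induction on the number of voters. *)

(** * Weak orders, their rank functions, and spreading a relation over pairs *)

Definition pref_lt (S : finType) (P : pref S) x y := ~~ pref_le P y x.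

Section PreferenceTheory.
Variable S : finType.
Implicit Types (P Q : pref S) (x y z : S).

Lemma pref_le_refl P x : pref_le P x x.
Proof. by have := pref_le_total P x x; rewrite orbb. Qed.

Lemma pref_ltW P x y : pref_lt P x y -> pref_le P x y.
Proof. by rewrite /pref_lt; case/orP: (pref_le_total P x y) => ->. Qed.

Lemma pref_lt_le_trans P y x z : pref_lt P x y -> pref_le P y z -> pref_lt P x z.
Proof. by move=> xy yz; apply: contra xy; apply: pref_le_trans. Qed.

Lemma pref_le_lt_trans P y x z : pref_le P x y -> pref_lt P y z -> pref_lt P x z.
Proof. by move=> xy yz; apply: contra yz => zx; apply: pref_le_trans xy. Qed.

Lemma pref_lt_trans P y x z : pref_lt P x y -> pref_lt P y z -> pref_lt P x z.
Proof. by move=> xy /pref_ltW; apply: pref_lt_le_trans. Qed.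

Lemma agree_lt P Q x y : pref_lt P x y -> pref_lt Q x y -> agree P Q x y.
Proof.
move=> ltP ltQ; split; first by rewrite !pref_ltW.
by rewrite (negbTE ltP) (negbTE ltQ).
Qed.

Lemma agree_sym P Q x y : agree P Q x y -> agree P Q y x.
Proof. by case. Qed.

Lemma agree_refl P Q x : agree P Q x x.
Proof. by split; rewrite !pref_le_refl. Qed.

Lemma eq_pref P Q : (forall x y, pref_le P x y = pref_le Q x y) -> P = Q.
Proof. by move=> PQ; apply/val_inj/setP=> -[x y]; apply: PQ. Qed.

Lemma mem_pref_class P A x y :
  A \in pref_classes P -> x \in A -> y \in A -> pref_eq P x y.
Proof.
case/imsetP=> z _ ->; rewrite !inE /= => /andP[zx xz] /andP[zy yz].
by rewrite /pref_eq (pref_le_trans xz zy) (pref_le_trans yz zx).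
Qed.

Lemma pref_class_ex P x y :
  pref_eq P x y -> exists A, [/\ A \in pref_classes P, x \in A & y \in A].
Proof.
move=> xy; exists [set z in [set: S] | pref_eq P x z]; split.
- exact: imset_f.
- by rewrite !inE /pref_eq pref_le_refl.
- by rewrite !inE.
Qed.

(** A numerical representation of [P]: it lets profiles be prescribed by natural numbers, so that
    comparisons reduce to arithmetic. *)
Definition pref_rank P x := #|[set z | pref_le P z x]|.

Lemma pref_rankE P x y : pref_le P x y = (pref_rank P x <= pref_rank P y).
Proof.
apply/idP/idP=> [xy|].
  by apply/subset_leq_card/subsetP=> z; rewrite !inE => /pref_le_trans; apply.
apply: contraTT => yx; rewrite -ltnNge.
apply/proper_card/properP; split.
  apply/subsetP=> z; rewrite !inE => zy.
  exact: pref_le_trans (pref_ltW yx).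
by exists x; rewrite !inE ?pref_le_refl.
Qed.

Lemma rank_rel_total (r : S -> nat) : total (fun x y => r x <= r y).
Proof. by move=> x y; apply: leq_total. Qed.

Lemma rank_rel_trans (r : S -> nat) : transitive (fun x y => r x <= r y).
Proof. by move=> y x z; apply: leq_trans. Qed.

Definition pref_of_rank (r : S -> nat) : pref S :=
  pref_of (@rank_rel_total r) (@rank_rel_trans r).

Lemma pref_of_rankE r x y : pref_le (pref_of_rank r) x y = (r x <= r y).
Proof. exact: pref_ofE. Qed.

Lemma pref_rev_total P : total (fun x y => pref_le P y x).
Proof. by move=> x y; apply: pref_le_total. Qed.

Lemma pref_rev_trans P : transitive (fun x y => pref_le P y x).
Proof. by move=> y x z yx zy; apply: pref_le_trans yx. Qed.

Definition pref_rev P := pref_of (@pref_rev_total P) (@pref_rev_trans P).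

Lemma pref_revE P x y : pref_le (pref_rev P) x y = pref_le P y x.
Proof. exact: pref_ofE. Qed.

Lemma third_alternative a b : 2 < #|S| -> exists2 c : S, c != a & c != b.
Proof.
move=> S3; suff /subsetPn[c _] : ~~ ([set: S] \subset [set a; b]).
  by rewrite !inE negb_or => /andP[]; exists c.
apply: contraL S3 => /subset_leq_card; rewrite cardsT cards2 -leqNgt.
by move=> /leq_trans; apply; case: eqP.
Qed.

(** Any ordered pair of distinct alternatives is reached from [(a, b)] by replacing one entry at a
    time, provided a third alternative is available for a detour. *)
Lemma pair_spread (W : S -> S -> Prop) a b :
    2 < #|S| -> a != b -> W a b ->
    (forall x y z, x != y -> z != x -> z != y -> W x y -> W x z) ->
    (forall x y z, x != y -> z != x -> z != y -> W x y -> W z y) ->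
  forall x y, x != y -> W x y.
Proof.
move=> S3 ab Wab stepr stepl.
have toR x y z : x != y -> z != x -> W x y -> W x z.
  by have [-> //|zy] := eqVneq z y; move=> xy zx; apply: stepr.
have toL x y z : x != y -> z != y -> W x y -> W z y.
  by have [-> //|zx] := eqVneq z x; move=> xy zy; apply: stepl.
move=> x y xy; have [ya|ya] := eqVneq y a; last first.
  by apply: (toL a); rewrite 1?eq_sym // ; [rewrite eq_sym | apply: (toR _ b)].
(* The target is now [(x, a)]. The route [(a, b)], [(c, b)], [(c, a)], [(x, a)] never puts the same
   alternative in both entries. *)
have [c ca cb] := third_alternative a b S3; subst y.
apply: (toL c) => //; apply: (toR _ b) => //; first by rewrite eq_sym.
exact: (toL a).
Qed.

End PreferenceTheory.

(** The gluing tool: the levels of three alternatives can be chosen freely for each voter. Each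
    comparison is given in both directions, as [agree] and [pref_lt] require. *)
Lemma profile3 (V S : finType) (a b c : S) (p q r : V -> nat) :
    a != b -> c != a -> c != b ->
  exists R : config V S, forall i,
    [/\ (pref_le (R i) a b = (p i <= q i)) * (pref_le (R i) b a = (q i <= p i)),
        (pref_le (R i) a c = (p i <= r i)) * (pref_le (R i) c a = (r i <= p i)) &
        (pref_le (R i) b c = (q i <= r i)) * (pref_le (R i) c b = (r i <= q i))]%type.
Proof.
move=> ab ca cb.
exists [ffun i => pref_of_rank (fun x =>
  if x == a then p i else if x == b then q i else r i)] => i.
by rewrite !ffunE !pref_of_rankE !eqxx (negbTE ca) (negbTE cb) eq_sym (negbTE ab).
Qed.

(** * Arrow's theorem by decisive sets *)

Section Wilson.
Variables (V S : finType) (f : swf V S).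
Hypotheses (S3 : 2 < #|S|) (f_iia : IIA f).

Let iia_le x y (P Q : config V S) :
  (forall i, agree (P i) (Q i) x y) -> pref_le (f P) x y = pref_le (f Q) x y.
Proof. by case/f_iia. Qed.

Let iia_lt x y (P Q : config V S) :
  (forall i, agree (P i) (Q i) x y) -> pref_lt (f P) x y = pref_lt (f Q) x y.
Proof. by case/f_iia=> _; rewrite /pref_lt => ->. Qed.

Definition decisive (G : {set V}) (a b : S) : Prop :=
  forall R : config V S, {in G, forall i, pref_lt (R i) a b} -> pref_lt (f R) a b.

Definition pareto : Prop := forall a b, a != b -> decisive [set: V] a b.

Section Arrow.
Hypothesis f_pareto : pareto.

Let par a b (R : config V S) :
  a != b -> (forall i, pref_lt (R i) a b) -> pref_lt (f R) a b.
Proof. by move=> ab Rab; apply: f_pareto => // i _. Qed.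

(** All voters are strict on [a], [b] here, so under IIA a single such profile settles the
    property. *)
Definition weakly_decisive (G : {set V}) a b : Prop := forall R : config V S,
  (forall i, if i \in G then pref_lt (R i) a b else pref_lt (R i) b a) ->
  pref_lt (f R) a b.

Lemma decisiveW G a b : decisive G a b -> weakly_decisive G a b.
Proof. by move=> dG R RG; apply: dG => i iG; have := RG i; rewrite iG. Qed.

(** Members of [G] place [b] between [a] and [c]; the others place [b] below both and keep their own
    ranking of [a] and [c]. Weak decisiveness gives [a] below [b], and Pareto gives [b] below
    [c]. *)
Lemma weakly_decisive_right G a b c : a != b -> c != a -> c != b ->
  weakly_decisive G a b -> decisive G a c.
Proof.
move=> ab ca cb wG R RG.
have [Q QE] := @profile3 V S a b c
  (* The successor leaves level 0 to [b] alone among the three, outside [G]. *)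
  (fun i => if i \in G then 0 else (pref_rank (R i) a).+1)
  (fun i => if i \in G then 1 else 0)
  (fun i => if i \in G then 2 else (pref_rank (R i) c).+1) ab ca cb.
rewrite (@iia_lt _ _ R Q) => [|i].
  apply: (@pref_lt_trans _ _ b).
    by apply: wG => i; have [Eab _ _] := QE i; rewrite /pref_lt !Eab; case: (i \in G); lia.
  apply: par => [|i]; first by rewrite eq_sym.
  by have [_ _ Ebc] := QE i; rewrite /pref_lt !Ebc; case: (i \in G); lia.
have [_ Eac _] := QE i; have [iG|iG] := boolP (i \in G).
  by apply: agree_lt; [apply: RG | rewrite /pref_lt !Eac iG].
by split; rewrite !Eac (negbTE iG) pref_rankE ltnS.
Qed.

(** The mirror argument: [G] ranks [c], [a], [b] upwards, and the others lift [a] above both [b] and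
    [c]. *)
Lemma weakly_decisive_left G a b c : a != b -> c != a -> c != b ->
  weakly_decisive G a b -> decisive G c b.
Proof.
move=> ab ca cb wG R RG.
pose top i := (pref_rank (R i) b + pref_rank (R i) c).+1.
have [Q QE] := @profile3 V S a b c
  (fun i => if i \in G then 1 else top i)
  (fun i => if i \in G then 2 else pref_rank (R i) b)
  (fun i => if i \in G then 0 else pref_rank (R i) c) ab ca cb.
rewrite (@iia_lt _ _ R Q) => [|i].
  apply: (@pref_lt_trans _ _ a).
    apply: par => // i.
    by have [_ Eac _] := QE i; rewrite /pref_lt !Eac /top; case: (i \in G); lia.
  by apply: wG => i; have [Eab _ _] := QE i; rewrite /pref_lt !Eab /top; case: (i \in G); lia.
have [_ _ Ebc] := QE i; have [iG|iG] := boolP (i \in G).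
  by apply: agree_lt; [apply: RG | rewrite /pref_lt !Ebc iG].
by split; rewrite !Ebc (negbTE iG) pref_rankE.
Qed.

Lemma weakly_decisive_spread G a b : a != b -> weakly_decisive G a b ->
  forall x y, x != y -> decisive G x y.
Proof.
move=> ab wG; have [c ca cb] := third_alternative a b S3.
have ac : a != c by rewrite eq_sym.
(* The spread starts at [(a, c)] because a first move is what turns weak decisiveness into
   decisiveness. *)
apply: (@pair_spread _ (decisive G) a c) => //.
- exact: (@weakly_decisive_right G a b c).
- by move=> x y z xy zx zy /decisiveW; apply: weakly_decisive_right.
- by move=> x y z xy zx zy /decisiveW; apply: weakly_decisive_left.
Qed.

(** Contraction of decisive sets: of [[set i]] and [G :\ i], one inherits decisiveness, so induction
    on the size of [G] reaches a single voter. *)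
Lemma decisive_singleton (G : {set V}) :
  (forall x y, x != y -> decisive G x y) ->
  exists i, forall x y, x != y -> decisive [set i] x y.
Proof.
have [n] := ubnP #|G|; elim: n => // n IHn in G *; rewrite ltnS => Gn dG.
have /card_gt0P[a _] := ltnW (ltnW S3).
have [b ba _] := third_alternative a a S3.
have [c ca cb] := third_alternative a b S3.
have ab : a != b by rewrite eq_sym.
(* An empty decisive set would force both strict rankings of [a] and [b] at once. *)
have [G0|[i iG]] := set_0Vmem G.
  have R : config V S := [ffun=> pref_of_rank (fun=> 0)].
  have /negP[] : pref_lt (f R) a b by apply: dG => // i; rewrite G0 inE.
  by apply/pref_ltW/dG => // i; rewrite G0 inE.
(* A Condorcet profile: upwards, [i] ranks [a], [b], [c], the rest of [G] ranks [c], [a], [b], and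
   everyone else [b], [c], [a]. Only [i] has [a] below [c], and only [G :\ i] has [c] below [b]. *)
have [R RE] := @profile3 V S a b c
  (fun j => if j == i then 0 else if j \in G then 1 else 2)
  (fun j => if j == i then 1 else if j \in G then 2 else 0)
  (fun j => if j == i then 2 else if j \in G then 0 else 1) ab ca cb.
have Rab : pref_lt (f R) a b.
  apply: dG => // j jG; have [Eab _ _] := RE j.
  by rewrite /pref_lt !Eab jG; case: (j == i).
have [Rca|Rac] := boolP (pref_le (f R) c a); last first.
  exists i; apply: (@weakly_decisive_spread _ a c); first by rewrite eq_sym.
  move=> Q QE; rewrite -(@iia_lt _ _ R) // => j.
  have [_ Eac _] := RE j; have := QE j; rewrite inE.
  case: eqVneq => [ji|ji] ltQ; first by apply: agree_lt; rewrite // /pref_lt !Eac ji eqxx.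
  by apply/agree_sym/agree_lt; rewrite // /pref_lt !Eac (negbTE ji); case: (j \in G).
apply: (IHn (G :\ i)); first by rewrite (cardsD1 i) iG in Gn.
apply: (@weakly_decisive_spread _ c b) => // Q QE.
rewrite -(@iia_lt _ _ R) => [|j]; first exact: pref_le_lt_trans Rab.
have [_ _ Ebc] := RE j; have := QE j; rewrite !inE.
case: eqVneq => [ji|ji] /=.
  by move=> ltQ; apply/agree_sym/agree_lt; rewrite // /pref_lt !Ebc ji eqxx.
case: ifP => jG ltQ; first by apply: agree_lt; rewrite // /pref_lt !Ebc (negbTE ji) jG.
by apply/agree_sym/agree_lt; rewrite // /pref_lt !Ebc (negbTE ji) jG.
Qed.

Theorem arrow : exists i, forall x y R, pref_le (f R) x y -> pref_le (R i) x y.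
Proof.
have [i di] := decisive_singleton f_pareto; exists i => x y R.
have [->|xy] := eqVneq x y; first by rewrite !pref_le_refl.
apply: contraTT => Ryx; apply: di => [|j]; first by rewrite eq_sym.
by rewrite inE => /eqP ->.
Qed.

End Arrow.

(** * Wilson's theorem: non-imposition in place of Pareto *)

Definition non_imposed : Prop := forall x y, exists R, pref_le (f R) x y.

Hypothesis f_ni : non_imposed.

(** One respected unanimous strict preference spreads to all pairs. Non-imposition supplies a
    profile with the needed weak social ranking of two alternatives; the third is then put
    unanimously below them (first move) or above them (second move). *)
Lemma unanimity_pareto (a b : S) (R : config V S) :
    a != b -> (forall i, pref_lt (R i) a b) -> pref_lt (f R) a b -> pareto.
Proof.
move=> ab Rab fab; apply: (@pair_spread _ (decisive [set: V]) a b) => //.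
- move=> Q Qab; rewrite (@iia_lt _ _ Q R) // => i.
  by apply: agree_lt; rewrite ?Qab ?inE.
- move=> x y z xy zx zy dxy Q Qxz; have [P Pyz] := f_ni y z.
  have [T TE] := @profile3 V S x y z (fun=> 0)
    (fun i => (pref_rank (P i) y).+1) (fun i => (pref_rank (P i) z).+1) xy zx zy.
  rewrite (@iia_lt _ _ Q T) => [|i].
    apply: (@pref_lt_le_trans _ _ y).
      by apply: dxy => i _; have [E _ _] := TE i; rewrite /pref_lt !E.
    rewrite (@iia_le _ _ T P) // => i; have [_ _ E] := TE i.
    by split; rewrite !E pref_rankE ltnS.
  have [_ E _] := TE i.
  by apply: agree_lt; [rewrite Qxz ?inE | rewrite /pref_lt !E].
- move=> x y z xy zx zy dxy Q Qzy; have [P Pzx] := f_ni z x.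
  have [T TE] := @profile3 V S x y z (fun i => pref_rank (P i) x)
    (fun i => (pref_rank (P i) x + pref_rank (P i) z).+1)
    (fun i => pref_rank (P i) z) xy zx zy.
  rewrite (@iia_lt _ _ Q T) => [|i].
    apply: (@pref_le_lt_trans _ _ x).
      rewrite (@iia_le _ _ T P) // => i; have [_ E _] := TE i.
      by split; rewrite !E pref_rankE.
    by apply: dxy => i _; have [E _ _] := TE i; rewrite /pref_lt !E; lia.
  have [_ _ E] := TE i.
  by apply: agree_lt; [rewrite Qzy ?inE | rewrite /pref_lt !E; lia].
Qed.

(* If [a] and [b] are both unanimously below [c], they are both socially
   indifferent to [c]; the individual comparisons of [a] and [b] stay free. *)
Lemma unanimity_ignored_null :
    (forall (a b : S) (R : config V S),
       a != b -> (forall i, pref_lt (R i) a b) -> pref_eq (f R) a b) ->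
  null f.
Proof.
move=> f_ign R a b; have [->|ab] := eqVneq a b; first by rewrite /pref_eq pref_le_refl.
have [c ca cb] := third_alternative a b S3.
have [T TE] := @profile3 V S a b c (fun i => pref_rank (R i) a)
  (fun i => pref_rank (R i) b)
  (fun i => (pref_rank (R i) a + pref_rank (R i) b).+1) ab ca cb.
have /andP[Tac Tca] : pref_eq (f T) a c.
  apply: f_ign => [|i]; first by rewrite eq_sym.
  by have [_ E _] := TE i; rewrite /pref_lt !E; lia.
have /andP[Tbc Tcb] : pref_eq (f T) b c.
  apply: f_ign => [|i]; first by rewrite eq_sym.
  by have [_ _ E] := TE i; rewrite /pref_lt !E; lia.
have [i|E1 E2] := @f_iia a b R T.
  by have [E _ _] := TE i; split; rewrite !E pref_rankE.
by rewrite /pref_eq E1 E2; apply/andP; split; apply: (@pref_le_trans _ _ c).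
Qed.

End Wilson.

(** Reversal exchanges the two orientations allowed by [dictator], so the inverse dictator is
    obtained from Arrow's theorem too. *)
Definition swf_rev (V S : finType) (f : swf V S) : swf V S := fun R => pref_rev (f R).

Lemma swf_rev_IIA (V S : finType) (f : swf V S) : IIA f -> IIA (swf_rev f).
Proof. by move=> fI x y P Q /fI[E1 E2]; split; rewrite !pref_revE. Qed.

Theorem wilson (V S : finType) (f : swf V S) :
  2 < #|S| -> IIA f -> non_imposed f -> null f \/ dictatorial f.
Proof.
move=> S3 f_iia f_ni.
(* A boolean over finite types, so the case analysis on [f] and its reversal is constructive. If
   neither is [respected], unanimous strict preferences become social ties. *)
pose respected (g : swf V S) := [exists a, exists b, exists R : {ffun V -> pref S},
  [&& a != b, [forall i, pref_lt (R i) a b] & pref_lt (g R) a b]].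
have respectedP (g : swf V S) : IIA g -> non_imposed g -> respected g -> pareto g.
  move=> gI gN /existsP[a /existsP[b /existsP[R /and3P[ab /forallP Rab gab]]]].
  exact: (unanimity_pareto S3 gI gN ab Rab gab).
have [fr|fNr] := boolP (respected f).
  have [i di] := arrow S3 f_iia (respectedP _ f_iia f_ni fr).
  by right; exists i; left.
have rI := swf_rev_IIA f_iia.
have rN : non_imposed (swf_rev f).
  by move=> x y; have [R Ryx] := f_ni y x; exists R; rewrite pref_revE.
have [rr|rNr] := boolP (respected (swf_rev f)).
  have [i di] := arrow S3 rI (respectedP _ rI rN rr).
  by right; exists i; right=> x y R fxy; apply: di; rewrite pref_revE.
left; apply: unanimity_ignored_null => // a b R ab Rab.
have Nresp g : ~~ respected g -> pref_le (g R) b a.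
  rewrite negb_exists => /forallP/(_ a); rewrite negb_exists => /forallP/(_ b).
  rewrite negb_exists => /forallP/(_ R); rewrite ab /=.
  by have -> : [forall i, pref_lt (R i) a b]; [apply/forallP | rewrite negbK].
by rewrite /pref_eq Nresp // andbT; have := Nresp _ rNr; rewrite pref_revE.
Qed.

(** * Restriction to a set of alternatives *)

Section Restriction.
Variables (V S : finType) (f : swf V S) (A : {set S}).

Definition config_res (R : config V S) : config V (subset_type A) :=
  [ffun i => pref_res A (R i)].

Lemma pref_resE (P : pref S) (x y : subset_type A) :
  pref_le (pref_res A P) x y = pref_le P (val x) (val y).
Proof. exact: pref_ofE. Qed.

Lemma pref_extE (P : pref (subset_type A)) (x y : subset_type A) :
  pref_le (pref_ext P) (val x) (val y) = pref_le P x y.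
Proof. by rewrite -pref_resE pref_extK. Qed.

Lemma swf_resE (R : config V (subset_type A)) x y :
  pref_le (swf_res f A R) x y = pref_le (f [ffun i => pref_ext (R i)]) (val x) (val y).
Proof. exact: pref_resE. Qed.

Lemma swf_res_config_res (R : config V S) x y : res_well_defined f A ->
  pref_le (swf_res f A (config_res R)) x y = pref_le (f R) (val x) (val y).
Proof.
move=> wd; rewrite /swf_res -[RHS]pref_resE; congr (pref_le _ x y).
by apply: (wd (config_res R)) => i; rewrite !ffunE ?pref_extK.
Qed.

Lemma IIA_res_well_defined : IIA f -> res_well_defined f A.
Proof.
move=> fI R P Q extP extQ; apply: eq_pref => x y; rewrite !pref_resE.
have [i|//] := fI (val x) (val y) P Q.
by split; rewrite -!pref_resE extP extQ.
Qed.

Lemma IIA_swf_res : IIA f -> IIA (swf_res f A).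
Proof.
move=> fI x y P Q PQ; rewrite /agree !swf_resE; apply: fI => i.
by rewrite /agree !ffunE !pref_extE; apply: PQ.
Qed.

End Restriction.

(** * The cleric, deference, and the direct implication *)

Section Cleric.
Variables (V S : finType) (f : swf V S).
Hypothesis f_iia : IIA f.

Definition attainable : rel S :=
  fun x y => [exists R : {ffun V -> pref S}, pref_le (f R) x y].

Lemma attainable_total : total attainable.
Proof.
move=> x y; pose R : {ffun V -> pref S} := [ffun=> pref_of_rank (fun=> 0)].
case/orP: (pref_le_total (f R) x y) => fR; apply/orP; [left | right];
  by apply/existsP; exists R.
Qed.

Lemma attainable_trans : transitive attainable.
Proof.
move=> y x z xy yz; have [-> //|neq_xy] := eqVneq x y.
have [<- //|zy] := eqVneq y z.
have [zx|zx] := eqVneq z x.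
  by subst z; have := attainable_total x x; rewrite orbb.
case/existsP: xy => P Pxy; case/existsP: yz => Q Qyz.
(* Adding ranks glues the profiles: [x] and [y] differ as in [P], with common offset the [Q]-rank of
   [y], while [y] and [z] differ as in [Q], with common offset the [P]-rank of [y]. *)
have [|R RE] := @profile3 V S x y z
  (fun i => pref_rank (P i) x + pref_rank (Q i) y)
  (fun i => pref_rank (P i) y + pref_rank (Q i) y)
  (fun i => pref_rank (P i) y + pref_rank (Q i) z) neq_xy zx; first by rewrite eq_sym.
apply/existsP; exists R; apply: (@pref_le_trans _ _ y).
  have [i|-> //] := f_iia (x := x) (y := y) (P := R) (Q := P).
  by have [E _ _] := RE i; split; rewrite !E pref_rankE leq_add2r.
have [i|-> //] := f_iia (x := y) (y := z) (P := R) (Q := Q).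
by have [_ _ E] := RE i; split; rewrite !E pref_rankE leq_add2l.
Qed.

Definition cleric : pref S := pref_of attainable_total attainable_trans.

Lemma clerical_cleric : clerical f cleric.
Proof. by move=> x y R fxy; rewrite pref_ofE; apply/existsP; exists R. Qed.

Lemma cleric_class_non_imposed A :
  A \in pref_classes cleric -> non_imposed (swf_res f A).
Proof.
move=> AC x y; have /andP[+ _] := mem_pref_class AC (valP x) (valP y).
rewrite pref_ofE => /existsP[R Rxy]; exists (config_res A R).
by rewrite swf_res_config_res //; apply: IIA_res_well_defined.
Qed.

Definition indifferent_config j (R : config (other_voters j) S) : config V S :=
  [ffun i => if insub i is Some k then R k else pref_of_rank (fun=> 0)].

(** Freezing [j] at total indifference changes nothing on a pair where [j] is already indifferent,
    so IIA identifies the two outcomes there. *)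
Lemma dictator_defers j : dictator f j ->
  exists2 g : swf (other_voters j) S, defers f j g & IIA g.
Proof.
move=> fj; exists (fun R => f (indifferent_config R)); last first.
  move=> x y P Q PQ; apply: f_iia => i; rewrite !ffunE.
  by case: insub => [k|]; [apply: PQ | split].
split=> // x y R Rxy.
suff [] : agree (f R) (f (indifferent_config (drop_voter j R))) x y by move=> ->.
apply: f_iia => i; rewrite !ffunE; case: insubP => [k _ <-|]; first by rewrite ffunE.
rewrite negbK => /eqP ->; rewrite /agree !pref_of_rankE.
by case/andP: Rxy => -> ->.
Qed.

End Cleric.

Lemma card_other_voters (V : finType) (j : V) : #|other_voters j| < #|V|.
Proof. by rewrite card_sig cardC1 ltn_predL; apply/card_gt0P; exists j. Qed.

Lemma IIA_clerical_dictatorial (V S : finType) (f : swf V S) :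
  IIA f -> clerical_dictatorial f.
Proof.
(* The induction generalizes over [V] and [S]: deference removes a voter and passes to a class of
   alternatives. *)
have [n] := ubnP #|V|; elim: n => // n IHn in V S f *; rewrite ltnS => Vn f_iia.
apply: (CD_cleric (C := cleric f_iia)); first exact: clerical_cleric.
move=> A AC; have rI := IIA_swf_res (A := A) f_iia; split.
- exact: IIA_res_well_defined.
- have cardA : #|subset_type A| = #|A| by rewrite card_sig.
  have [A2|A3|A2] := ltngtP #|A| 2; last by constructor 3.
  + constructor 1 => R x y; have -> : x = y; last by rewrite /pref_eq pref_le_refl.
    by apply: (fintype_le1P (T := subset_type A)); rewrite cardA -ltnS.
  + have [|||] := wilson _ rI; rewrite ?cardA //.
    * exact: cleric_class_non_imposed.
    * by constructor 1.
    * by constructor 2.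
- move=> j /(dictator_defers rI)[g gd gI]; exists g => //.
  exact/IHn/gI/(leq_trans (card_other_voters j)).
Qed.

(** * The converse implication *)

Lemma null_IIA (V S : finType) (f : swf V S) : null f -> IIA f.
Proof.
move=> f0 x y P Q _; have /andP[Pxy Pyx] := f0 P x y.
by have /andP[Qxy Qyx] := f0 Q x y; rewrite /agree Pxy Pyx Qxy Qyx.
Qed.

(** If [x] and [y] differ they exhaust [S], so profiles agreeing on them are equal. *)
Lemma IIA_small (V S : finType) (f : swf V S) : #|S| <= 2 -> IIA f.
Proof.
move=> S2 x y P Q PQ; have [->|xy] := eqVneq x y; first exact: agree_refl.
have xyT z : (z == x) || (z == y).
  have : [set x; y] == [set: S] by rewrite eqEcard subsetT cardsT cards2 xy.
  by move/eqP/setP/(_ z); rewrite !inE.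
suff -> : P = Q by [].
apply/ffunP=> i; have [E1 E2] := PQ i; apply: eq_pref => u v.
by case/orP: (xyT u) => /eqP ->; case/orP: (xyT v) => /eqP ->;
  rewrite // !pref_le_refl.
Qed.

(** If [j] is indifferent on the pair, [g] decides; otherwise [j] alone fixes a strict social
    ranking, in either orientation of the dictatorship. *)
Lemma defers_IIA (V S : finType) (f : swf V S) j (g : swf (other_voters j) S) :
  defers f j g -> IIA g -> IIA f.
Proof.
case=> fj fg gI x y P Q PQ; have [E1 E2] := PQ j.
have [Pxy|] := boolP (pref_eq (P j) x y).
  have Qxy : pref_eq (Q j) x y by rewrite /pref_eq -E1 -E2.
  have [|G1 G2] := gI x y (drop_voter j P) (drop_voter j Q).
    by move=> k; rewrite !ffunE.
  have eqC R : pref_eq (R j) x y -> pref_eq (R j) y x by rewrite /pref_eq andbC.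
  split; apply/idP/idP.
  - by move/(fg _ _ _ Pxy); rewrite G1 => /(fg _ _ _ Qxy).
  - by move/(fg _ _ _ Qxy); rewrite -G1 => /(fg _ _ _ Pxy).
  - by move/(fg _ _ _ (eqC _ Pxy)); rewrite G2 => /(fg _ _ _ (eqC _ Qxy)).
  - by move/(fg _ _ _ (eqC _ Qxy)); rewrite -G2 => /(fg _ _ _ (eqC _ Pxy)).
rewrite negb_and => /orP[] nP; case: fj => fj.
- by apply/agree_sym/agree_lt; apply: contra nP => /fj; rewrite ?E1.
- by apply/agree_lt; apply: contra nP => /fj; rewrite ?E1.
- by apply/agree_lt; apply: contra nP => /fj; rewrite ?E2.
- by apply/agree_sym/agree_lt; apply: contra nP => /fj; rewrite ?E2.
Qed.

Lemma clerical_dictatorial_IIA (V S : finType) (f : swf V S) :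
  clerical_dictatorial f -> IIA f.
Proof.
have [n] := ubnP #|V|; elim: n => // n IHn in V S f *; rewrite ltnS => Vn.
case=> [f0|S2|C fC fA].
- exact: null_IIA.
- exact: IIA_small.
(* A pair split by [C] has an imposed strict ranking; any other pair lies in one class, where the
   restriction is treated. *)
move=> x y P Q PQ; have [Cxy|] := boolP (pref_eq C x y); last first.
  rewrite negb_and => /orP[] nC; last by apply: agree_lt; apply: contra nC; apply: fC.
  by apply/agree_sym/agree_lt; apply: contra nC; apply: fC.
have [A [AC xA yA]] := pref_class_ex Cxy.
have [wd cases fj] := fA A AC.
suff rI : IIA (swf_res f A).
  have := rI (Sub x xA) (Sub y yA) (config_res A P) (config_res A Q).
  rewrite /agree !swf_res_config_res //=; apply=> i.
  by rewrite /agree !ffunE !pref_resE; apply: PQ.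
case: cases => [r0|[j rj]|A2].
- exact: null_IIA.
- have [g gd gCD] := fj j rj; apply: (defers_IIA gd).
  exact/IHn/gCD/(leq_trans (card_other_voters j)).
- by apply: IIA_small; rewrite card_sig A2.
Qed.

Theorem theorem6 (S : finType) (N : nat) (f : swf 'I_N S) :
  IIA f <-> clerical_dictatorial f.
Proof.
by split; [apply: IIA_clerical_dictatorial | apply: clerical_dictatorial_IIA].
Qed.
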